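(* Let $k\ge1$, $\lambda_1,\dots,\lambda_k>0$, and let $\{M(s,t),\ (s,t)\in\mathbb{R}^2_+\}\sim GPRF\{\lambda_j\}_{1\le j\le k}$. Its probability generating function $G(z,s,t)=\mathbb{E}z^{M(s,t)}$, $|z|\le1$, solves the differential equation $$\frac{\partial^2}{\partial t\,\partial s}G(z,s,t)=\sum_{j=1}^{k}\lambda_j(z^j-1)G(z,s,t)+\sum_{j=1}^{k}\sum_{j'=1}^{k}\lambda_j\lambda_{j'}\sum_{r=1}^{j'}\big(z^{j+j'-r}-z^{j'-r}\big)\frac{\partial}{\partial\lambda_1}G(z,s,t),$$ with initial conditions $G(z,0,t)=G(z,s,0)=G(z,0,0)=1$ for all $s,t\ge0$.
   Context: $\mathbb{R}_+=[0,\infty)$. For a two parameter process $X$ and $s\le s'$, $t\le t'$, the rectangular increment is $\Delta_{s,t}X(s',t')=X(s',t')-X(s',t)-X(s,t')+X(s,t)$. Two parameter generalized Poisson random field $\{M(s,t),\ (s,t)\in\mathbb{R}^2_+\}\sim GPRF\{\lambda_j\}_{1\le j\le k}$: a non-negative integer valued process with $M(0,t)=M(s,0)=0$ almost surely, with independent rectangular increments over disjoint rectangles $(s,s']\times(t,t']$, and with $$\Pr\{\Delta_{s,t}M(s',t')=n\}=\sum_{(n_1,\dots,n_k)\in\Theta(k,n)}\prod_{j=1}^{k}\frac{(\lambda_j(s'-s)(t'-t))^{n_j}}{n_j!}e^{-\lambda_j(s'-s)(t'-t)},\quad n\ge0,$$ where $\Theta(k,n)=\{(n_1,\dots,n_k)\in\mathbb{N}_0^k:\sum_{j=1}^kjn_j=n\}$.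 The derivative $\partial/\partial\lambda_1$ regards $G$ as a function of the parameters $\lambda_1,\dots,\lambda_k$ as well. *)

(* Defs.v *)
From HB Require Import structures.
From mathcomp Require Import all_boot all_order all_algebra.
From mathcomp Require Import all_classical all_reals all_analysis.
From mathcomp Require Import complex.
Import Order.TTheory GRing.Theory Num.Theory numFieldNormedType.Exports.

Set Implicit Arguments.
Unset Strict Implicit.
Unset Printing Implicit Defensive.

Local Open Scope classical_set_scope.
Local Open Scope ring_scope.
Local Open Scope complex_scope.

(* Mutual independence of a finite family of int-valued random variables. The
   sigma-algebra on int is the discrete one, so every B i is measurable, and
   B i = setT yields the product rule for subfamilies. *)
Definition mutually_independent d (T : measurableType d) (R : realType)
    (P : probability T R) (m : nat) (X : 'I_m -> T -> int) : Prop :=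
  forall B : 'I_m -> set int,
    P (\bigcap_(i in [set: 'I_m]) X i @^-1` B i)
    = (\prod_(i < m) P (X i @^-1` B i))%E.

Definition rect_incr (R : realType) (T : Type) (M : R -> R -> T -> nat)
    (s s' t t' : R) (w : T) : int :=
  (M s' t' w)%:Z - (M s' t w)%:Z - (M s t' w)%:Z + (M s t w)%:Z.

(* The set Theta(k,n) is indexed by {ffun 'I_k -> 'I_n.+1}: the constraint
   forces every n_j <= n. The index j : 'I_k stands for j.+1 in {1, ..., k}. *)
Definition gprf_pmf (R : realType) (k : nat) (lam : 'I_k -> R) (a : R)
    (n : nat) : R :=
  \sum_(v : {ffun 'I_k -> 'I_n.+1} | (\sum_(j < k) j.+1 * v j)%N == n)
    \prod_(j < k) ((lam j * a) ^+ v j / (v j)`!%:R * expR (- (lam j * a))).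

(* Only the values M s t with 0 <= s and 0 <= t are constrained. *)
Record GPRF d (T : measurableType d) (R : realType) (P : probability T R)
    (k : nat) (lam : 'I_k -> R) (M : R -> R -> T -> nat) : Prop := {
  gprf_measurable : forall s t, 0 <= s -> 0 <= t ->
    measurable_fun setT (M s t) ;
  gprf_axis_s : forall t, 0 <= t -> {ae P, forall w, M 0 t w = 0%N} ;
  gprf_axis_t : forall s, 0 <= s -> {ae P, forall w, M s 0 w = 0%N} ;
  gprf_indep : forall (m : nat) (s s' t t' : 'I_m -> R),
    (forall i, 0 <= s i <= s' i) -> (forall i, 0 <= t i <= t' i) ->
    trivIset setT (fun i => `]s i, s' i] `*` `]t i, t' i]) ->
    mutually_independent P (fun i => rect_incr M (s i) (s' i) (t i) (t' i)) ;
  gprf_law : forall s s' t t', 0 <= s <= s' -> 0 <= t <= t' ->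
    forall n : nat,
      P [set w | rect_incr M s s' t t' w = n%:Z]
      = (gprf_pmf lam ((s' - s) * (t' - t)) n)%:E }.

Definition cexpectation d (T : measurableType d) (R : realType)
    (P : probability T R) (X : T -> R[i]) : R[i] :=
  fine 'E_P[fun w => complex.Re (X w)] +i* fine 'E_P[fun w => complex.Im (X w)].

Definition pgf d (T : measurableType d) (R : realType) (P : probability T R)
    (M : R -> R -> T -> nat) (z : R[i]) (s t : R) : R[i] :=
  cexpectation P (fun w => z ^+ M s t w).

(* Derivative at x of a complex-valued function of a real variable defined on
   D: the usual derivative at interior points of D, the one-sided one at an
   endpoint belonging to D. Limits are taken in R[i]^o, i.e., in R[i] with the
   topology of its modulus. *)
Definition diff_quot (R : realType) (f : R -> R[i]) (x h : R) : R[i]^o :=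
  (h^-1)%:C * (f (x + h) - f x).

Definition derivable_on (R : realType) (D : set R) (f : R -> R[i]) (x : R)
    : Prop :=
  cvg (diff_quot f x h @[h --> within [set h | D (x + h)] 0^']).

Definition derive_on (R : realType) (D : set R) (f : R -> R[i]) (x : R)
    : R[i] :=
  lim (diff_quot f x h @[h --> within [set h | D (x + h)] 0^']).

(* Main.v *)
Require Import Defs.
From HB Require Import structures.
From mathcomp Require Import all_boot all_order all_algebra.
From mathcomp Require Import all_classical all_reals all_analysis.
From mathcomp Require Import measurable_realfun complex ring lra zify.
Import Order.TTheory GRing.Theory Num.Theory numFieldNormedType.Exports.

Set Implicit Arguments.
Unset Strict Implicit.
Unset Printing Implicit Defensive.

Local Open Scope classical_set_scope.
Local Open Scope ring_scope.
Local Open Scope complex_scope.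

(** The generating function is [G(z,s,t) = exp (s t L)] with
    [L = \sum_j lam_j (z^j - 1)], from which the equation follows by
    differentiation, because [\partial_lam_1 G = s t (z - 1) G] and
    [(z - 1) \sum_r (z^(j+j'-r) - z^(j'-r)) = (z^j - 1) (z^j' - 1)].
    To identify [G], compare the truncated series [\sum_(n <= N) p_n z^n] with
    [exp (- a \sum_j lam_j)] times the product over [j] of the exponential
    Taylor sums of order [N] at [lam_j a z^j], where [a = s t]. The difference
    collects the terms of total degree larger than [N], all of which have
    nonnegative weights, so it is largest at [z = 1]; there it tends to 0
    because both sides tend to 1, the law having total mass 1. *)

(** * The complex exponential and convergence in [R[i]] *)

Definition cexp (R : realType) (w : R[i]) : R[i] :=
  (expR (complex.Re w) * cos (complex.Im w)) +i*
  (expR (complex.Re w) * sin (complex.Im w)).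

Lemma cexpD (R : realType) (v w : R[i]) : cexp (v + w) = cexp v * cexp w.
Proof.
case: v w => [a b] [c d]; rewrite /cexp /= expRD cosD sinD.
by apply/eqP; rewrite eq_complex /=; apply/andP; split; apply/eqP; ring.
Qed.

Lemma cexp0 (R : realType) : cexp 0 = 1 :> R[i].
Proof. by rewrite /cexp /= expR0 cos0 sin0 mulr1 mulr0. Qed.

Lemma cexp_real (R : realType) (x : R) : cexp x%:C = (expR x)%:C.
Proof. by rewrite /cexp /= cos0 sin0 mulr1 mulr0. Qed.

Lemma normr_cexp (R : realType) (w : R[i]) :
  `|cexp w| = (expR (complex.Re w))%:C.
Proof.
rewrite normc_def /cexp /= !exprMn -mulrDr cos2Dsin2 mulr1 sqrtr_sqr.
by rewrite ger0_norm// expR_ge0.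
Qed.

Lemma cexp_sum (R : realType) (I : Type) (s : seq I) (F : I -> R[i]) :
  cexp (\sum_(i <- s) F i) = \prod_(i <- s) cexp (F i).
Proof. by rewrite (big_morph _ (@cexpD R) (cexp0 R)). Qed.

Lemma normr_real_complex (R : realType) (x : R) : `|x%:C| = `|x|%:C.
Proof. by rewrite normc_def /= expr0n addr0 sqrtr_sqr. Qed.

Lemma normc_ge_Im (R : realType) (w : R[i]) : `|complex.Im w|%:C <= `|w|.
Proof.
by case: w => a b; rewrite normc_def lecR /= -sqrtr_sqr
  ler_wsqrtr// lerDr sqr_ge0.
Qed.

Lemma normc_le_ReIm (R : realType) (w : R[i]) :
  `|w| <= (`|complex.Re w| + `|complex.Im w|)%:C.
Proof.
rewrite {1}(complexE w) (le_trans (ler_normD _ _))// normrM rmorphD/=.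
rewrite !normr_real_complex normc_def /= expr0n expr1n add0r sqrtr1 mul1r.
exact: lexx.
Qed.

Lemma cvg_real_complex (R : realType) (T : Type) (F : set_system T)
    (FF : Filter F) (u : T -> R) (a : R) :
  u x @[x --> F] --> a -> ((u x)%:C : R[i]^o) @[x --> F] --> (a%:C : R[i]^o).
Proof.
move=> ua; apply/cvgrPdist_le => e e0.
have eE : e = (complex.Re e)%:C by rewrite RRe_real// gtr0_real.
have e'0 : 0 < complex.Re e by rewrite -ltcR -eE.
move/cvgrPdist_le : ua => /(_ _ e'0); apply: filterS => x.
by rewrite {2}eE -rmorphB/= normr_real_complex lecR.
Qed.

Lemma cvg_complex (R : realType) (T : Type) (F : set_system T)
    (FF : Filter F) (u v : T -> R) (a b : R) :
  u x @[x --> F] --> a -> v x @[x --> F] --> b ->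
  ((u x +i* v x) : R[i]^o) @[x --> F] --> ((a +i* b) : R[i]^o).
Proof.
move=> ua vb.
rewrite (complexE (a +i* b)) [X in X @ _](_ : _ =
  (fun x => ((u x)%:C : R[i]^o)) \+
  (fun x => ('i : R[i]^o) * ((v x)%:C : R[i]^o))); last first.
  by apply/funext => x; exact: (complexE (u x +i* v x)).
apply: cvgD; first exact: cvg_real_complex.
by apply: cvgMr; exact: cvg_real_complex.
Qed.

Lemma squeeze_cvgC (R : realType) (T : Type) (F : set_system T)
    (FF : Filter F) (f : T -> R[i]) (l : R[i]) (g : T -> R) :
  (forall x, `|f x - l| <= (g x)%:C) -> g x @[x --> F] --> 0 ->
  (f x : R[i]^o) @[x --> F] --> (l : R[i]^o).
Proof.
move=> fg g0; apply/cvgrPdist_le => e e0.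
have eE : e = (complex.Re e)%:C by rewrite RRe_real// gtr0_real.
have e'0 : 0 < complex.Re e by rewrite -ltcR -eE.
move/cvgrPdist_le : g0 => /(_ _ e'0); apply: filterS => x.
rewrite sub0r normrN => gx.
rewrite distrC (le_trans (fg x))// eE lecR (le_trans (ler_norm _))//.
Qed.

(** * Derivatives of complex-valued functions of a real variable *)

(* The derivative of a complex-valued function of a real variable, taken
   componentwise to make the real derivation lemmas available. *)
Definition is_cderive (R : realType) (f : R -> R[i]) (x : R) (df : R[i]) :=
  is_derive x 1 (fun y => complex.Re (f y)) (complex.Re df) /\
  is_derive x 1 (fun y => complex.Im (f y)) (complex.Im df).

Lemma is_cderive_eq (R : realType) (f : R -> R[i]) (x : R) (df dg : R[i]) :
  is_cderive f x df -> df = dg -> is_cderive f x dg.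
Proof. by move=> + <-. Qed.

Lemma is_cderive_cst (R : realType) (c : R[i]) (x : R) :
  is_cderive (fun=> c) x 0.
Proof. by split; exact: is_derive_cst. Qed.

Lemma is_cderive_id (R : realType) (x : R) :
  is_cderive (fun y => y%:C) x 1.
Proof. by split => /=; [exact: is_derive_id|exact: is_derive_cst]. Qed.

Lemma is_cderiveD (R : realType) (f g : R -> R[i]) (x : R) (df dg : R[i]) :
  is_cderive f x df -> is_cderive g x dg ->
  is_cderive (fun y => f y + g y) x (df + dg).
Proof.
have ReD (a b : R[i]) : complex.Re (a + b) = complex.Re a + complex.Re b.
  by case: a b => [? ?] [? ?].
have ImD (a b : R[i]) : complex.Im (a + b) = complex.Im a + complex.Im b.
  by case: a b => [? ?] [? ?].
move=> [fr fi] [gr gi]; split.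
  rewrite ReD; under eq_fun do rewrite ReD; exact: (is_deriveD fr gr).
rewrite ImD; under eq_fun do rewrite ImD; exact: (is_deriveD fi gi).
Qed.

Lemma is_cderiveM (R : realType) (f g : R -> R[i]) (x : R) (df dg : R[i]) :
  is_cderive f x df -> is_cderive g x dg ->
  is_cderive (fun y => f y * g y) x (df * g x + f x * dg).
Proof.
move=> [fr fi] [gr gi]; split.
  rewrite (_ : (fun _ => _) =
    (fun y => complex.Re (f y)) * (fun y => complex.Re (g y)) -
    (fun y => complex.Im (f y)) * (fun y => complex.Im (g y))); last first.
    by apply/funext => y; rewrite /= !fctE; case: (f y) (g y) => [? ?] [? ?].
  apply: is_derive_eq.
  case: df dg fr fi gr gi => [? ?] [? ?] _ _ _ _ /=.
  by case: (f x) (g x) => [? ?] [? ?] /=; rewrite /GRing.scale /=; ring.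
rewrite (_ : (fun _ => _) =
  (fun y => complex.Re (f y)) * (fun y => complex.Im (g y)) +
  (fun y => complex.Im (f y)) * (fun y => complex.Re (g y))); last first.
  by apply/funext => y; rewrite /= !fctE; case: (f y) (g y) => [? ?] [? ?].
apply: is_derive_eq.
case: df dg fr fi gr gi => [? ?] [? ?] _ _ _ _ /=.
by case: (f x) (g x) => [? ?] [? ?] /=; rewrite /GRing.scale /=; ring.
Qed.

Lemma is_cderiveMr (R : realType) (f : R -> R[i]) (c : R[i]) (x : R)
    (df : R[i]) :
  is_cderive f x df -> is_cderive (fun y => f y * c) x (df * c).
Proof.
move=> fx; apply: is_cderive_eq (is_cderiveM fx (is_cderive_cst c x)) _.
by rewrite mulr0 addr0.
Qed.

Lemma is_cderiveX (R : realType) (f : R -> R[i]) (n : nat) (x : R)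
    (df : R[i]) :
  is_cderive f x df ->
  is_cderive (fun y => f y ^+ n.+1) x (n.+1%:R * f x ^+ n * df).
Proof.
move=> fx; elim: n => [|n ih].
  by apply: is_cderive_eq fx _; rewrite expr0 !mul1r.
rewrite (_ : (fun _ => _) = (fun y => f y * f y ^+ n.+1)); last first.
  by apply/funext => y; rewrite exprS.
apply: is_cderive_eq (is_cderiveM fx ih) _.
by rewrite -[in RHS]natr1 exprS; ring.
Qed.

Lemma is_cderive_cexp (R : realType) (f : R -> R[i]) (x : R) (df : R[i]) :
  is_cderive f x df ->
  is_cderive (fun y => cexp (f y)) x (cexp (f x) * df).
Proof.
move=> [fr fi].
have er := is_derive1_comp (is_derive_expR (complex.Re (f x))) fr.
have ec := is_derive1_comp (is_derive_cos (complex.Im (f x))) fi.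
have es := is_derive1_comp (is_derive_sin (complex.Im (f x))) fi.
split.
  rewrite (_ : (fun _ => _) =
    (expR \o (fun y => complex.Re (f y))) *
    (cos \o (fun y => complex.Im (f y)))) //.
  apply: (is_derive_eq (is_deriveM er ec)).
  rewrite /cexp; case: df fr fi {er ec es} => ? ? _ _.
  by move=> /=; case: (f x) => ? ? /=; rewrite /GRing.scale /=; ring.
rewrite (_ : (fun _ => _) =
  (expR \o (fun y => complex.Re (f y))) *
  (sin \o (fun y => complex.Im (f y)))) //.
apply: (is_derive_eq (is_deriveM er es)).
rewrite /cexp; case: df fr fi {er ec es} => ? ? _ _.
by move=> /=; case: (f x) => ? ? /=; rewrite /GRing.scale /=; ring.
Qed.

(** * Convergence of the exponential series *)

Lemma MVT_bound01 (R : realType) (f df : R -> R) (B : R) :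
  (forall x : R, is_derive x 1 f (df x)) ->
  (forall x, 0 <= x <= 1 -> `|df x| <= B) -> `|f 1 - f 0| <= B.
Proof.
move=> fdf dfB.
have [|c] := @MVT R f df 0 1 ltr01 (fun x _ => fdf x).
  by apply: derivable_within_continuous => x _; have [] := fdf x.
rewrite in_itv /= => /andP[c0 c1] ->.
by rewrite subr0 mulr1 dfB// !ltW.
Qed.

(** The mean value theorem fails for complex values, so it is applied to the real and imaginary
    parts separately; each is dominated by the modulus, whence the bound [B + B]. *)
Lemma cMVT_bound01 (R : realType) (f df : R -> R[i]) (B : R) :
  (forall x, is_cderive f x (df x)) ->
  (forall x, 0 <= x <= 1 -> `|df x| <= B%:C) ->
  `|f 1 - f 0| <= (B + B)%:C.
Proof.
move=> fdf dfB; apply: (le_trans (normc_le_ReIm _)).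
rewrite lecR lerD//.
  have := @MVT_bound01 R (fun x => complex.Re (f x))
    (fun x => complex.Re (df x)) B (fun x => (fdf x).1).
  case: (f 1) (f 0) => [? ?] [? ?] /=; apply => x x01.
  by rewrite -lecR (le_trans (normc_ge_Re _))// dfB.
have := @MVT_bound01 R (fun x => complex.Im (f x))
  (fun x => complex.Im (df x)) B (fun x => (fdf x).2).
case: (f 1) (f 0) => [? ?] [? ?] /=; apply => x x01.
by rewrite -lecR (le_trans (normc_ge_Im _))// dfB.
Qed.

Definition exp_partial (F : fieldType) (N : nat) (x : F) : F :=
  \sum_(i < N) x ^+ i / i`!%:R.

(** The derivative of each new top term is the preceding term of the series times [c]; the one-term
    sum is constant, matching the empty sum at [N = 0]. *)
Lemma is_cderive_exp_partial (R : realType) (c : R[i]) (N : nat) (x : R) :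
  is_cderive (fun y => exp_partial N.+1 (y%:C * c)) x
    (exp_partial N (x%:C * c) * c).
Proof.
elim: N => [|N ih].
  rewrite (_ : (fun _ => _) = (fun=> 1)).
    by rewrite /exp_partial big_ord0 mul0r; exact: is_cderive_cst.
  by apply/funext => y; rewrite /exp_partial big_ord1 divr1.
rewrite (_ : (fun _ => _) = (fun y => exp_partial N.+1 (y%:C * c) +
  (y%:C * c) ^+ N.+1 * (N.+1)`!%:R^-1)); last first.
  by apply/funext => y; rewrite /exp_partial big_ord_recr.
have d1 : is_cderive (fun y : R => y%:C * c) x (1 * c).
  by apply: is_cderiveMr; exact: is_cderive_id.
have d2 := is_cderiveMr ((N.+1)`!%:R^-1) (is_cderiveX N d1).
apply: is_cderive_eq (is_cderiveD ih d2) _.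
rewrite [in RHS]/exp_partial big_ord_recr /= -/(exp_partial N _) mulrDl.
congr (_ + _); rewrite factS natrM invfM.
have : N.+1%:R != 0 :> R[i] by rewrite pnatr_eq0.
have : N`!%:R != 0 :> R[i] by rewrite pnatr_eq0 -lt0n fact_gt0.
by move=> *; field; apply/andP.
Qed.

(* [y |-> cexp (- y c) * exp_partial N.+1 (y c)] has the small derivative
   [- cexp (- y c) * c (y c) ^ N / N!]. *)
Lemma cvg_exp_partial (R : realType) (c : R[i]) :
  (exp_partial N.+1 c : R[i]^o) @[N --> \oo] --> (cexp c : R[i]^o).
Proof.
pose r := complex.Re `|c|.
have rE : `|c| = r%:C by rewrite RRe_real// normr_real.
have r0 : 0 <= r by rewrite -ler0c -rE.
(* [B N] bounds the derivative of [D N] on the unit interval: [cexp (- y c)] has modulus at most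
   [expR r], and [c (y c)^N / N!] at most [r * r^N / N!]. *)
pose B N := expR r * (r * exp_coeff r N).
pose D N (y : R) := cexp (y%:C * - c) * exp_partial N.+1 (y%:C * c).
have DB N : `|D N 1 - D N 0| <= (B N + B N)%:C.
  apply: (@cMVT_bound01 _ _ (fun y => - cexp (y%:C * - c) *
    (c * ((y%:C * c) ^+ N / N`!%:R)))) => y.
    have d1 : is_cderive (fun y : R => y%:C * - c) y (1 * - c).
      by apply: is_cderiveMr; exact: is_cderive_id.
    apply: is_cderive_eq
      (is_cderiveM (is_cderive_cexp d1) (is_cderive_exp_partial c N y)) _.
    by rewrite {1}/exp_partial big_ord_recr /= -/(exp_partial N _); ring.
  move=> /andP[y0 y1].
  have nat_norm (m : nat) : `|m%:R : R[i]| = m%:R by rewrite normr_nat.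
  rewrite !normrM normrN normr_cexp normfV nat_norm normrX normrM rE.
  rewrite normr_real_complex (ger0_norm y0) /B /exp_coeff/=.
  have -> : (N`!%:R : R[i]) = (N`!%:R : R)%:C by rewrite rmorph_nat.
  rewrite -fmorphV -rmorphM -rmorphXn -!rmorphM lecR.
  apply: ler_pM; [exact: expR_ge0| | |].
  - by rewrite !mulr_ge0// ?exprn_ge0// ?mulr_ge0// invr_ge0 ler0n.
  - rewrite ler_expR.
    have : `|complex.Re (y%:C * - c)|%:C <= `|y%:C * - c|.
      exact: normc_ge_Re.
    rewrite normrM normrN rE normr_real_complex (ger0_norm y0) -rmorphM lecR.
    move=> h; rewrite (le_trans (ler_norm _))// (le_trans h)//.
    by rewrite ler_piMl.
  - rewrite ler_wpM2l// ler_wpM2r ?invr_ge0 ?ler0n//.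
    rewrite lerXn2r ?nnegrE ?mulr_ge0//.
    by rewrite ler_piMl.
(* Since [D N 0 = 1] and [cexp c] cancels the factor [cexp (- c)] in [D N 1], the error of the
   partial sum is [cexp c] times the increment of [D N]. *)
have DE N : exp_partial N.+1 c - cexp c = cexp c * (D N 1 - D N 0).
  have -> : D N 0 = 1.
    rewrite /D !mul0r cexp0 mul1r /exp_partial big_ord_recl /= big1 ?addr0.
      by rewrite expr0 divr1.
    by move=> i _; rewrite exprS !mul0r.
  by rewrite /D !mul1r mulrBr mulr1 mulrA -cexpD subrr cexp0 mul1r.
have B0 : (expR (complex.Re c) * (B N + B N)) @[N --> \oo] --> 0.
  have e0 := cvg_series_cvg_0 (is_cvg_series_exp_coeff r).
  have b0 : B N @[N --> \oo] --> 0.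
    rewrite -(mulr0 (expR r)); apply: cvgMr.
    by rewrite -(mulr0 r); apply: cvgMr.
  rewrite -[X in _ --> X](mulr0 (expR (complex.Re c))); apply: cvgMr.
  by rewrite -[X in _ --> X](addr0 0); exact: cvgD.
apply: squeeze_cvgC B0 => N.
rewrite DE normrM normr_cexp [in leRHS]rmorphM.
by rewrite ler_wpM2l// ler0c expR_ge0.
Qed.

(** * Derivatives relative to a domain *)

(** If [D] contains everything to the right of [x], small positive increments stay in [D].
    Properness makes the limit in [derive_on] unique, also at the endpoint 0 of the closed
    half-line. *)
Lemma within_oright_proper (R : realType) (D : set R) (x : R) :
  (forall y, x <= y -> D y) ->
  ProperFilter (within [set h | D (x + h)] (0 : R)^').
Proof.
move=> Dx; apply: Build_ProperFilter_ex => A.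
rewrite /within /= /dnbhs => /= /nbhs_ballP[e /= e0 eA].
exists (e / 2); apply: eA => /=.
- by rewrite /ball /= sub0r normrN gtr0_norm ?divr_gt0//
    ltr_pdivrMr// ltr_pMr// ltr1n.
- by rewrite gt_eqF// divr_gt0.
- by apply: Dx; rewrite lerDl ltW// divr_gt0.
Qed.

(** The restricted filter sees only increments that stay in [D], where [f] and [g] agree. The
    two-sided derivative of [g] thus yields the possibly one-sided derivative of [f]. *)
Lemma cvg_diff_quot (R : realType) (D : set R) (f g : R -> R[i]) (x : R)
    (dg : R[i]) :
  D x -> (forall y, D y -> f y = g y) -> is_cderive g x dg ->
  diff_quot f x h @[h --> within [set h | D (x + h)] 0^'] --> (dg : R[i]^o).
Proof.
move=> Dx fg [[gr1 gr2] [gi1 gi2]].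
have sub : within [set h | D (x + h)] (0 : R)^' `=>` (0 : R)^'.
  by move=> A; rewrite /within /=; apply: filterS.
set W := within _ _ in sub *.
have WF : Filter W by exact: within_filter.
have cr : h^-1 *: (complex.Re (g (h *: 1 + x)) - complex.Re (g x))
    @[h --> W] --> complex.Re dg.
  by apply: (cvg_trans (cvg_app _ sub)); rewrite -gr2; exact: gr1.
have ci : h^-1 *: (complex.Im (g (h *: 1 + x)) - complex.Im (g x))
    @[h --> W] --> complex.Im dg.
  by apply: (cvg_trans (cvg_app _ sub)); rewrite -gi2; exact: gi1.
have := cvg_complex WF cr ci.
rewrite (_ : complex.Re dg +i* complex.Im dg = dg); last by case: (dg).
apply: cvg_trans; apply: near_eq_cvg.
have : W [set h | D (x + h)] by exact: withinT.
apply: filterS => h /= Dxh.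
rewrite /diff_quot (fg _ Dx) (fg _ Dxh) /GRing.scale /= mulr1 (addrC h).
by case: (g _) (g x) => [? ?] [? ?]; simpc.
Qed.

Lemma is_cderive_on (R : realType) (D : set R) (f g : R -> R[i]) (x : R)
    (dg : R[i]) :
  (forall y, x <= y -> D y) ->
  (forall y, D y -> f y = g y) -> is_cderive g x dg ->
  derivable_on D f x /\ derive_on D f x = dg.
Proof.
move=> xD fg gx; have PF := within_oright_proper xD.
have c := cvg_diff_quot (xD x (lexx x)) fg gx.
split; first by apply/cvg_ex; exists dg.
by apply: cvg_lim c; exact: norm_hausdorff.
Qed.

(** * Truncated generating function as a sum over multi-indices *)

(** The entries range up to a fixed [N] independent of the weight, so that the probabilities of all
    [n <= N] become sums over one index type. *)
Definition theta_weight (k N : nat) (v : {ffun 'I_k -> 'I_N.+1}) : nat :=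
  (\sum_(j < k) j.+1 * v j)%N.

Definition theta_term (R : realType) (k : nat) (lam : 'I_k -> R) (a : R)
    (N : nat) (v : {ffun 'I_k -> 'I_N.+1}) : R :=
  \prod_(j < k) ((lam j * a) ^+ v j / (v j)`!%:R * expR (- (lam j * a))).

(** A multi-index of weight [n] has all entries at most [n], so allowing entries up to [N] adds no
    solutions. *)
Lemma gprf_pmf_widen (R : realType) (k : nat) (lam : 'I_k -> R) (a : R)
    (n N : nat) : (n <= N)%N ->
  gprf_pmf lam a n =
  \sum_(v : {ffun 'I_k -> 'I_N.+1} | theta_weight v == n) theta_term lam a v.
Proof.
move=> nN; rewrite /gprf_pmf.
pose h (v : {ffun 'I_k -> 'I_n.+1}) : {ffun 'I_k -> 'I_N.+1} :=
  [ffun j => inord (v j)].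
pose h' (v : {ffun 'I_k -> 'I_N.+1}) : {ffun 'I_k -> 'I_n.+1} :=
  [ffun j => inord (v j)].
have hE v j : h v j = v j :> nat.
  by rewrite ffunE inordK// (leq_trans (ltn_ord _)).
rewrite (reindex_onto h h') => [|v /eqP vn].
  apply: eq_big => [v|v _]; last by apply: eq_bigr => j _; rewrite hE.
  have -> : theta_weight (h v) = (\sum_(j < k) j.+1 * v j)%N.
    by apply: eq_bigr => j _; rewrite hE.
  rewrite [X in _ && X](_ : _ = true) ?andbT//.
  by apply/eqP/ffunP => j; rewrite ffunE hE inord_val.
(* [h] inverts [h'] at a vector of weight [n], because [v j <= j.+1 * v j <= n] and the cast back to
   ['I_n.+1] loses nothing. *)
apply/ffunP => j; apply/val_inj; rewrite /= hE ffunE inordK// ltnS -vn.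
rewrite /theta_weight (bigD1 j)//= (leq_trans _ (leq_addr _ _))//.
by rewrite leq_pmull.
Qed.

Lemma sum_gprf_pmf_exp (R : realType) (k : nat) (lam : 'I_k -> R) (a : R)
    (z : R[i]) (N : nat) :
  \sum_(n < N.+1) (gprf_pmf lam a n)%:C * z ^+ n =
  \sum_(v : {ffun 'I_k -> 'I_N.+1} | (theta_weight v < N.+1)%N)
    (theta_term lam a v)%:C * z ^+ theta_weight v.
Proof.
rewrite [RHS](partition_big
  (fun v => inord (theta_weight v) : 'I_N.+1) xpredT)//=.
apply: eq_bigr => n _; rewrite (@gprf_pmf_widen _ _ _ _ _ N) -1?ltnS//.
rewrite rmorph_sum mulr_suml /=.
have E (v : {ffun 'I_k -> 'I_N.+1}) : (theta_weight v < N.+1)%N &&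
    (inord (theta_weight v) == n :> 'I_N.+1) = (theta_weight v == n).
  apply/andP/eqP => [[vN /eqP <-]|vn]; first by rewrite inordK.
  by rewrite vn; split=> //; apply/eqP; rewrite inord_val.
rewrite (eq_bigl _ _ E); apply: eq_bigr => v /eqP -> //.
Qed.

(** Expanding the product chooses one term [v j] in each factor, and the exponents [j.+1 * v j] of
    [z] add up to the weight of [v]. No constraint on the weight arises, in contrast to
    [sum_gprf_pmf_exp]. *)
Lemma prod_exp_partial (R : realType) (k : nat) (lam : 'I_k -> R) (a : R)
    (z : R[i]) (N : nat) :
  \prod_(j < k) (exp_partial N.+1 ((lam j * a)%:C * z ^+ j.+1) *
                 cexp (- (lam j * a)%:C)) =
  \sum_(v : {ffun 'I_k -> 'I_N.+1})
    (theta_term lam a v)%:C * z ^+ theta_weight v.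
Proof.
under eq_bigr do rewrite /exp_partial mulr_suml.
rewrite bigA_distr_bigA /=; apply: eq_bigr => v _.
rewrite /theta_term rmorph_prod -prodrXr -big_split /=.
apply: eq_bigr => j _.
by rewrite -rmorphN cexp_real exprMn -exprM !rmorphM
  fmorphV rmorphXn rmorph_nat rmorphM /=; ring.
Qed.

(** The order of [R[i]] compares only numbers with equal imaginary parts, so the inequality also
    says that the right-hand side is real and nonnegative. *)
Lemma gprf_truncation_error (R : realType) (k : nat) (lam : 'I_k -> R) (a : R)
    (z : R[i]) (N : nat) :
  (forall j, 0 <= lam j * a) -> `|z| <= 1 ->
  `|\prod_(j < k) (exp_partial N.+1 ((lam j * a)%:C * z ^+ j.+1) *
                   cexp (- (lam j * a)%:C)) -
    \sum_(n < N.+1) (gprf_pmf lam a n)%:C * z ^+ n| <=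
  \prod_(j < k) (exp_partial N.+1 ((lam j * a)%:C * 1 ^+ j.+1) *
                   cexp (- (lam j * a)%:C)) -
    \sum_(n < N.+1) (gprf_pmf lam a n)%:C * 1 ^+ n.
Proof.
move=> a0 z1; rewrite !prod_exp_partial !sum_gprf_pmf_exp.
have E (F : {ffun 'I_k -> 'I_N.+1} -> R[i]) :
    \sum_v F v - \sum_(v | (theta_weight v < N.+1)%N) F v =
    \sum_(v | ~~ (theta_weight v < N.+1)%N) F v.
  by rewrite [X in X - _](bigID (fun v => (theta_weight v < N.+1)%N)) /=
    addrAC subrr add0r.
rewrite !E (le_trans (ler_norm_sum _ _ _))// ler_sum// => v _.
have w0 : 0 <= theta_term lam a v.
  apply: prodr_ge0 => j _; rewrite mulr_ge0 ?expR_ge0// divr_ge0// exprn_ge0//.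
rewrite normrM normr_real_complex (ger0_norm w0) ler_wpM2l ?ler0c//.
by rewrite normrX expr1n; apply: exprn_ile1.
Qed.

(** * The law of [M s t] and expectations as series *)

Lemma measurable_nat_comp d (T : measurableType d) d' (U : measurableType d')
    (X : T -> nat) (g : nat -> U) :
  measurable_fun setT X -> measurable_fun setT (fun w => g (X w)).
Proof. by move=> mX; apply: (@measurableT_comp _ _ _ _ _ _ g _ X). Qed.

Lemma measurable_nat_fiber d (T : measurableType d) (X : T -> nat) (n : nat) :
  measurable_fun setT X -> measurable [set w | X w = n].
Proof.
move=> mX; rewrite (_ : [set _ | _] = setT `&` X @^-1` [set n]); last first.
  by rewrite setTI.
exact: mX.
Qed.

(** Joining the exceptional null set [N] to both sets changes neither measure and makes the two sets
    equal. *)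
Lemma measure_ae_eq_set d (T : measurableType d) (R : realType)
    (mu : {measure set T -> \bar R}) (A B : set T) :
  measurable A -> measurable B -> {ae mu, forall w, A w <-> B w} ->
  mu A = mu B.
Proof.
move=> mA mB [N [mN N0 ABN]].
rewrite -(measureU0 mA mN N0) -(measureU0 mB mN N0); congr (mu _).
apply/seteqP; split => w [] h;
  (case: (pselect (N w)) => [|nN]; [by right|left => //]);
  (apply/not_notP => nh; apply: nN; apply: ABN => /=; tauto).
Qed.

(** The increment over the rectangle from the origin to [(s, t)] equals [M s t] almost surely, the
    values on the axes being almost surely zero. *)
Lemma gprf_law_origin d (T : measurableType d) (R : realType)
    (P : probability T R) (k : nat) (lam : 'I_k -> R) (M : R -> R -> T -> nat)
    (s t : R) (n : nat) :
  GPRF P lam M -> 0 <= s -> 0 <= t ->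
  P [set w | M s t w = n] = (gprf_pmf lam (s * t) n)%:E.
Proof.
move=> [mM Ms Mt _ law] s0 t0.
have := law 0 s 0 t; rewrite !lexx s0 t0 !subr0 => /(_ isT isT n) <-.
have mMR (x y : R) : 0 <= x -> 0 <= y ->
    measurable_fun setT (fun w => (M x y w)%:R : R).
  by move=> x0 y0; apply: (@measurable_nat_comp _ _ _ R (M x y) (fun n => n%:R));
    exact: mM.
apply: measure_ae_eq_set.
- by apply: measurable_nat_fiber; exact: mM.
(* The increment is integer valued; measurability of its level set is obtained from its real-valued
   copy [f], the embedding of the integers being injective. *)
- pose f w : R := (M s t w)%:R - (M s 0 w)%:R - (M 0 t w)%:R + (M 0 0 w)%:R.
  have mf : measurable_fun setT f.
    apply: measurable_funD;
      [by apply: measurable_funB; [apply: measurable_funB|]; exact: mMR|];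
      exact: mMR.
  rewrite (_ : [set _ | _] = setT `&` f @^-1` [set n%:R]).
    by apply: mf => //; exact: measurable_set1.
  rewrite setTI; apply/seteqP; split => w /=; rewrite /f /rect_incr => h.
    by have := congr1 (fun i : int => i%:~R : R) h; rewrite rmorphD !rmorphB.
  by apply: (@intr_inj R); rewrite rmorphD !rmorphB.
- have h0 := Ms _ t0; have h1 := Mt _ s0; have h2 := Ms 0 (lexx 0).
  apply: filterS3 h0 h1 h2 => w h0 h1 h2.
  rewrite /= /rect_incr h0 h1 h2.
  rewrite (_ : _ + _ = (M s t w)%:Z); last by lia.
  by split => [->//|[]].
Qed.

(** The fibres of [X] partition the space and the integrand is constant on each, so the integral of
    this nonnegative function is a series; the bound [B] makes its value finite and the convergence
    real. *)
Lemma cvg_expectation_nat_ge0 d (T : measurableType d) (R : realType)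
    (P : probability T R) (X : T -> nat) (p g : nat -> R) (B : R) :
  measurable_fun setT X -> (forall n, P [set w | X w = n] = (p n)%:E) ->
  (forall n, 0 <= g n <= B) ->
  P.-integrable setT (fun w => (g (X w))%:E) /\
  (\sum_(n < N) p n * g n) @[N --> \oo] -->
    fine (\int[P]_w (g (X w))%:E)%E.
Proof.
move=> mX Xp gB.
have ig : P.-integrable setT (fun w => (g (X w))%:E).
  apply: (@measurable_bounded_integrable _ _ _ P (fun w => g (X w)))=> //.
  - by rewrite [ltLHS](@probability_setT _ _ _ P) ltry.
  - exact: (@measurable_nat_comp _ _ _ R X g).
  - exists B; split; first exact: num_real.
    move=> y By w _ /=; have /andP[g0 gw] := gB (X w).
    by rewrite ger0_norm// (le_trans gw)// ltW.
split => //.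
pose F n := [set w | X w = n].
have mF n : measurable (F n).
  exact: measurable_nat_fiber.
have UF : \bigcup_n F n = setT by apply/seteqP; split => // w _; exists (X w).
have tF : trivIset setT F.
  apply/trivIsetP => i j _ _ /eqP ij; apply/seteqP; split => // w [/= Xi Xj].
  by apply: ij; rewrite -Xi -Xj.
have intF n : (\int[P]_(w in F n) (g (X w))%:E)%E = (p n * g n)%:E.
  transitivity (\int[P]_(w in F n) (cst (g n)%:E w))%E.
    by apply: eq_integral => w; rewrite inE /F /= => ->.
  rewrite integral_cst// mulrC EFinM; congr (_ * _)%E; exact: Xp.
have p0 n : 0 <= p n by rewrite -lee_fin -Xp.
have pg0 n : (0 <= (p n * g n)%:E)%E.
  by rewrite lee_fin mulr_ge0//; have /andP[] := gB n.
have E : (\int[P]_w (g (X w))%:E)%E = (\sum_(0 <= n <oo) (p n * g n)%:E)%E.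
  rewrite -UF integral_bigcup// ?UF//.
  by apply: eq_eseriesr => n _; exact: intF.
have finE := integrable_fin_num measurableT ig.
have c : (\sum_(0 <= n < N) (p n * g n)%:E)%E @[N --> \oo] -->
    (fine (\int[P]_w (g (X w))%:E))%:E.
  by rewrite fineK// E; apply: is_cvg_nneseries => n _ _; exact: pg0.
have [_] := (fine_cvgP _ _).1 c.
apply: cvg_trans; apply: near_eq_cvg; near=> N.
by rewrite /= sumEFin /= big_mkord.
Unshelve. all: by end_near. Qed.

(** The nonnegative case is applied to [g + 1], which lies between 0 and 2, and to the constant 1;
    the two results are subtracted. *)
Lemma cvg_expectation_nat d (T : measurableType d) (R : realType)
    (P : probability T R) (X : T -> nat) (p g : nat -> R) :
  measurable_fun setT X -> (forall n, P [set w | X w = n] = (p n)%:E) ->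
  (forall n, `|g n| <= 1) ->
  (\sum_(n < N) p n * g n) @[N --> \oo] --> fine 'E_P[fun w => g (X w)].
Proof.
move=> mX Xp g1.
have [|i2 c2] := @cvg_expectation_nat_ge0 _ _ _ P X p
    (fun n => g n + 1) 2 mX Xp.
  by move=> n; have := g1 n; rewrite ler_norml => /andP[? ?];
    apply/andP; split; lra.
have [|i1 c1] := @cvg_expectation_nat_ge0 _ _ _ P X p (fun=> 1) 1 mX Xp.
  by move=> n; rewrite ler01 lexx.
have -> : ('E_P[fun w => g (X w)] =
    \int[P]_w (g (X w) + 1)%:E - \int[P]_w 1%:E)%E.
  rewrite unlock -integralB//; apply: eq_integral => w _.
  by rewrite -EFinB addrK.
rewrite fineB ?(integrable_fin_num measurableT)//.
rewrite [X in X @ _](_ : _ = (fun N => \sum_(n < N) p n * (g n + 1)) -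
  (fun N => \sum_(n < N) p n * 1)); first exact: (cvgB c2 c1).
by apply/funext => N; rewrite !fctE -sumrB; apply: eq_bigr => n _; ring.
Qed.

(** The weights are real, so the series splits into real and imaginary parts, just as [cexpectation]
    does. The sums run to degree [N] inclusive, hence the index shift. *)
Lemma cvg_pgf d (T : measurableType d) (R : realType) (P : probability T R)
    (M : R -> R -> T -> nat) (p : nat -> R) (z : R[i]) (s t : R) :
  measurable_fun setT (M s t) ->
  (forall n, P [set w | M s t w = n] = (p n)%:E) -> `|z| <= 1 ->
  ((\sum_(n < N.+1) (p n)%:C * z ^+ n) : R[i]^o) @[N --> \oo] -->
    (pgf P M z s t : R[i]^o).
Proof.
move=> mX Xp z1.
have zn n : `|z ^+ n| <= 1 by rewrite normrX; apply: exprn_ile1.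
have cr : (\sum_(n < N.+1) p n * complex.Re (z ^+ n)) @[N --> \oo] -->
    fine 'E_P[fun w => complex.Re (z ^+ M s t w)].
  rewrite (cvg_shiftS (fun N => \sum_(n < N) p n * complex.Re (z ^+ n))).
  apply: (cvg_expectation_nat (g := fun n => complex.Re (z ^+ n)) mX Xp) => n.
  by rewrite -lecR (le_trans (normc_ge_Re _)).
have ci : (\sum_(n < N.+1) p n * complex.Im (z ^+ n)) @[N --> \oo] -->
    fine 'E_P[fun w => complex.Im (z ^+ M s t w)].
  rewrite (cvg_shiftS (fun N => \sum_(n < N) p n * complex.Im (z ^+ n))).
  apply: (cvg_expectation_nat (g := fun n => complex.Im (z ^+ n)) mX Xp) => n.
  by rewrite -lecR (le_trans (normc_ge_Im _)).
rewrite [X in X @ _](_ : _ = fun N : nat =>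
  ((\sum_(n < N.+1) p n * complex.Re (z ^+ n)) +i*
   (\sum_(n < N.+1) p n * complex.Im (z ^+ n)) : R[i]^o)).
  exact: (cvg_complex _ cr ci).
apply/funext => N; elim: N.+1 => [|n ih]; first by rewrite !big_ord0.
by rewrite !big_ord_recr /= ih; case: (z ^+ n) => x y; simpc.
Qed.

(** * Identification of the generating function *)

Lemma cvg_prod_exp_partial (R : realType) (k : nat) (lam : 'I_k -> R) (a : R)
    (z : R[i]) :
  (\prod_(j < k) (exp_partial N.+1 ((lam j * a)%:C * z ^+ j.+1) *
     cexp (- (lam j * a)%:C)) : R[i]^o) @[N --> \oo] -->
  (cexp (a%:C * \sum_(j < k) (lam j)%:C * (z ^+ j.+1 - 1)) : R[i]^o).
Proof.
rewrite mulr_sumr cexp_sum.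
apply: (@cvg_big R[i]^o _ *%R) => [|j _]; first exact: mul_continuous.
rewrite (_ : a%:C * _ = (lam j * a)%:C * z ^+ j.+1 - (lam j * a)%:C).
  by rewrite cexpD; apply: cvgMl; exact: cvg_exp_partial.
by rewrite rmorphM /=; ring.
Qed.

Lemma pgf_gprf d (T : measurableType d) (R : realType) (P : probability T R)
    (k : nat) (lam : 'I_k -> R) (M : R -> R -> T -> nat) (z : R[i]) (s t : R) :
  GPRF P lam M -> (forall j, 0 < lam j) -> `|z| <= 1 -> 0 <= s -> 0 <= t ->
  pgf P M z s t =
  cexp ((s * t)%:C * \sum_(j < k) (lam j)%:C * (z ^+ j.+1 - 1)).
Proof.
move=> PM lam0 z1 s0 t0.
have pgfE (x : R[i]) : `|x| <= 1 -> ((\sum_(n < N.+1)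
    (gprf_pmf lam (s * t) n)%:C * x ^+ n) : R[i]^o) @[N --> \oo] -->
    (pgf P M x s t : R[i]^o).
  apply: cvg_pgf; first by case: PM => mM _ _ _ _; exact: mM.
  by move=> n; exact: gprf_law_origin.
have e1 : `|1 : R[i]| <= 1 by rewrite normr1.
have pgf1 : pgf P M 1 s t = 1.
  rewrite /pgf /cexpectation.
  under [in X in X +i* _]eq_fun do rewrite expr1n.
  under [in X in _ +i* X]eq_fun do rewrite expr1n.
  by rewrite /= !expectation_cst.
have cexp1 : cexp ((s * t)%:C * \sum_(j < k) (lam j)%:C * (1 ^+ j.+1 - 1)) = 1.
  rewrite big1 ?mulr0 ?cexp0// => j _.
  by rewrite expr1n subrr mulr0.
pose Q (x : R[i]) N : R[i]^o :=
  \prod_(j < k) (exp_partial N.+1 ((lam j * (s * t))%:C * x ^+ j.+1) *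
     cexp (- (lam j * (s * t))%:C)).
pose S (x : R[i]) N : R[i]^o :=
  \sum_(n < N.+1) (gprf_pmf lam (s * t) n)%:C * x ^+ n.
have QSx x : `|x| <= 1 -> (Q x N - S x N) @[N --> \oo] -->
    (cexp ((s * t)%:C * \sum_(j < k) (lam j)%:C * (x ^+ j.+1 - 1))
      - pgf P M x s t : R[i]^o).
  move=> x1.
  exact: cvgB (@cvg_prod_exp_partial R k lam (s * t) x) (pgfE x x1).
(* At 1 both limits are 1: the generating function is the expectation of the constant 1, and the
   exponent vanishes. This replaces a direct summation of the probabilities. *)
have err : (Q 1 N - S 1 N) @[N --> \oo] --> (0 : R[i]^o).
  by have := QSx 1 e1; rewrite cexp1 pgf1 subrr.
have QS : (Q z N - S z N) @[N --> \oo] --> (0 : R[i]^o).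
  apply/cvgrPdist_le => e e0; move/cvgrPdist_le : err => /(_ e e0).
  apply: filterS => N; rewrite !sub0r !normrN; apply: le_trans.
  have a0 j : 0 <= lam j * (s * t) by rewrite !mulr_ge0// ltW.
  apply: (le_trans (gprf_truncation_error N a0 z1)).
  exact: real_ler_norm (ger0_real (le_trans (normr_ge0 _)
    (gprf_truncation_error N a0 z1))).
by apply/esym/subr0_eq;
  exact: (cvg_unique (@norm_hausdorff _ R[i]^o) (QSx z z1) QS).
Qed.

(** * The differential equation *)

(** Each summand is a power of [z] times [z^(j+1) - 1]. Reversing the order of [r] turns these
    powers into [z^i] for [i <= j'], a geometric sum that [z - 1] telescopes. As [r <= j'.+1], the
    natural subtractions never truncate. *)
Lemma sum_geometric_diff (F : comNzRingType) (z : F) (j j' : nat) :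
  (\sum_(1 <= r < j'.+2) (z ^+ (j.+1 + j'.+1 - r) - z ^+ (j'.+1 - r)))
    * (z - 1) = (z ^+ j.+1 - 1) * (z ^+ j'.+1 - 1).
Proof.
rewrite big_add1 big_mkord (reindex_inj rev_ord_inj) /= (subrX1 z j'.+1).
rewrite (eq_bigr (fun i : 'I_j'.+1 => (z ^+ j.+1 - 1) * z ^+ i)); last first.
  move=> i _; have ij := ltn_ord i.
  have -> : (j.+1 + j'.+1 - (j'.+1 - i.+1).+1 = j.+1 + i)%N by lia.
  have -> : (j'.+1 - (j'.+1 - i.+1).+1 = i)%N by lia.
  by rewrite exprD; ring.
by rewrite -mulr_sumr; ring.
Qed.

(** The exponent of the generating function is affine in each of [s], [t] and the first parameter;
    [e] holds the part free of the variable. *)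
Lemma is_cderive_cexp_lin (R : realType) (c e : R[i]) (x : R) :
  is_cderive (fun y => cexp (y%:C * c + e)) x (cexp (x%:C * c + e) * c).
Proof.
apply: is_cderive_cexp.
have d1 : is_cderive (fun y : R => y%:C * c) x (1 * c).
  by apply: is_cderiveMr; exact: is_cderive_id.
by apply: is_cderive_eq
  (is_cderiveD d1 (is_cderive_cst e x)) _; rewrite mul1r addr0.
Qed.

(** One field is given for each positive parameter vector, possibly on its own probability space:
    the derivative in the first parameter varies the law, and the generating function depends on
    nothing else. *)
Theorem mainTheorem4 (R : realType) (k : nat) (k_gt0 : (0 < k)%N)
    (d : ('I_k -> R) -> measure_display)
    (Omega : forall lam : 'I_k -> R, measurableType (d lam))
    (P : forall lam : 'I_k -> R, probability (Omega lam) R)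
    (M : forall lam : 'I_k -> R, R -> R -> Omega lam -> nat)
    (M_GPRF : forall lam : 'I_k -> R, (forall j, 0 < lam j) ->
      GPRF (P lam) lam (M lam))
    (lam : 'I_k -> R) (lam_gt0 : forall j, 0 < lam j)
    (z : R[i]) (z_le1 : `|z| <= 1) :
  let G := fun (mu : 'I_k -> R) (s t : R) => pgf (P mu) (M mu) z s t in
  let j1 := Ordinal k_gt0 in
  let Rplus := [set x : R | 0 <= x] in
  let Rpos := [set x : R | 0 < x] in
  let dG_ds := fun s t : R => derive_on Rplus (fun x => G lam x t) s in
  let d2G_dtds := fun s t : R => derive_on Rplus (fun y => dG_ds s y) t in
  let G_lam1 := fun s t x : R => G [eta lam with j1 |-> x] s t in
  let dG_dlam1 := fun s t : R => derive_on Rpos (G_lam1 s t) (lam j1) in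
  (forall s t : R, 0 <= s -> 0 <= t ->
    [/\ derivable_on Rplus (fun x => G lam x t) s,
        derivable_on Rplus (fun y => dG_ds s y) t,
        derivable_on Rpos (G_lam1 s t) (lam j1) &
        d2G_dtds s t =
          \sum_(j < k) (lam j)%:C * (z ^+ j.+1 - 1) * G lam s t
          + \sum_(j < k) \sum_(j' < k) (lam j * lam j')%:C *
              (\sum_(1 <= r < j'.+2)
                 (z ^+ (j.+1 + j'.+1 - r) - z ^+ (j'.+1 - r))) *
              dG_dlam1 s t])
  /\ (forall s t : R, 0 <= s -> 0 <= t ->
       [/\ G lam 0 t = 1, G lam s 0 = 1 & G lam 0 0 = 1]).
Proof.
move=> G j1 Rplus Rpos dG_ds d2G_dtds G_lam1 dG_dlam1.
pose L := \sum_(j < k) (lam j)%:C * (z ^+ j.+1 - 1).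
have GE s t : 0 <= s -> 0 <= t -> G lam s t = cexp ((s * t)%:C * L).
  by move=> s0 t0; apply: pgf_gprf => //; exact: M_GPRF.
split; last first.
  by move=> s t s0 t0; rewrite !GE// !(mul0r, mulr0) ?mul0r cexp0.
have ds s t : 0 <= s -> 0 <= t ->
    derivable_on Rplus (fun x => G lam x t) s /\
    dG_ds s t = cexp ((s * t)%:C * L) * (t%:C * L).
  move=> s0 t0.
  apply: (@is_cderive_on _ _ _ (fun x => cexp (x%:C * (t%:C * L) + 0))).
  - by move=> y; exact: le_trans.
  - by move=> y y0; rewrite GE// addr0 rmorphM mulrA.
  - apply: is_cderive_eq (is_cderive_cexp_lin _ _ _) _.
    by congr (cexp _ * _); rewrite addr0 rmorphM mulrA.
have dtds s t : 0 <= s -> 0 <= t ->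
    derivable_on Rplus (fun y => dG_ds s y) t /\
    d2G_dtds s t = cexp ((s * t)%:C * L) * (L + (s * t)%:C * L ^+ 2).
  move=> s0 t0.
  (* The first derivative is known in closed form only for [y >= 0]; this formula extends it to all
     real [y]. *)
  apply: (@is_cderive_on _ _ _
    (fun y => cexp (y%:C * (s%:C * L) + 0) * (y%:C * L))).
  - by move=> y; exact: le_trans.
  - move=> y y0; rewrite (ds s y s0 y0).2; congr (cexp _ * _).
    by rewrite addr0 rmorphM /= mulrCA mulrA.
  - have d1 : is_cderive (fun y : R => y%:C * L) t (1 * L).
      by apply: is_cderiveMr; exact: is_cderive_id.
    apply: is_cderive_eq (is_cderiveM (is_cderive_cexp_lin _ _ _) d1) _.
    rewrite addr0 (_ : t%:C * (s%:C * L) = (s * t)%:C * L).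
      by rewrite rmorphM /=; ring.
    by rewrite rmorphM /=; ring.
have dl s t : 0 <= s -> 0 <= t ->
    derivable_on Rpos (G_lam1 s t) (lam j1) /\
    dG_dlam1 s t = cexp ((s * t)%:C * L) * ((s * t)%:C * (z - 1)).
  move=> s0 t0.
  (* [L'] gathers the terms free of the first parameter; index [j1] is 0, so its own term carries
     [z^1 - 1]. *)
  pose L' := \sum_(j < k | j != j1) (lam j)%:C * (z ^+ j.+1 - 1).
  have LE : L = (lam j1)%:C * (z - 1) + L' by rewrite /L (bigD1 j1).
  apply: (@is_cderive_on _ _ _
    (fun x => cexp (x%:C * ((s * t)%:C * (z - 1)) + (s * t)%:C * L'))).
  - by move=> y; exact: lt_le_trans.
  - move=> y y0; rewrite /G_lam1 /G.
    (* On [Rpos] the modified vector stays positive, so the closed form applies to its field as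
       well. *)
    have mu0 j : 0 < [eta lam with j1 |-> y] j by rewrite /=; case: ifP.
    rewrite (pgf_gprf (M_GPRF _ mu0))//.
    rewrite (bigD1 j1)//= ?eqxx mulrDr mulrCA; congr (cexp (_ + _ * _)).
    by apply: eq_bigr => j /negbTE ->.
  - apply: is_cderive_eq (is_cderive_cexp_lin _ _ _) _.
    by congr (cexp _ * _); rewrite LE [RHS]mulrDr [in RHS]mulrCA.
move=> s t s0 t0; split; [exact: (ds s t s0 t0).1|exact: (dtds s t s0 t0).1|
  exact: (dl s t s0 t0).1|].
rewrite (dtds s t s0 t0).2 (dl s t s0 t0).2 GE// -mulr_suml -/L mulrDr mulrC.
congr (_ + _).
(* Once the terms linear in [L] are matched, [L^2] remains. In its double sum, each product is
   traded for the sum over [r] times the factor [z - 1] supplied by the derivative in the first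
   parameter. *)
rewrite (_ : L ^+ 2 = \sum_(j < k) \sum_(j' < k) (lam j * lam j')%:C *
    ((z ^+ j.+1 - 1) * (z ^+ j'.+1 - 1))).
  rewrite mulrA mulr_sumr; apply: eq_bigr => j _.
  rewrite mulr_sumr; apply: eq_bigr => j' _.
  by rewrite -sum_geometric_diff; ring.
rewrite expr2 {1}/L mulr_suml; apply: eq_bigr => j _.
rewrite mulr_sumr; apply: eq_bigr => j' _.
by rewrite rmorphM /=; ring.
Qed.
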